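(* Let $\ell=\ell_1\cup\cdots\cup\ell_d\subset\mathbb S^3$ be an oriented link with group $\pi=\pi_1(\mathbb S^3\setminus\ell)$, let $R$ be a ring with $\mathbb Z\subset R\subset\mathbb Q$, and let $\gamma:\pi\to \mathrm{GL}_N R$ be a representation. Then the Pontryagin dual $\widehat{\mathcal A^0_\gamma}$ of the based $\gamma$-twisted Alexander module, with the $\mathbb Z^d$-action dual to multiplication by the monomials $t^{\mathbf n}$ ($\mathbf n\in\mathbb Z^d$), is topologically conjugate to the based $\gamma$-twisted coloring dynamical system $(\mathrm{Col}^0_\gamma(\ell),\sigma)$.
   Context: Pontryagin dual: $\hat M=\mathrm{Hom}(M,\mathbb T)$, $\mathbb T=\mathbb R/\mathbb Z$, for a discrete abelian group $M$. Two $\mathbb Z^d$-actions by automorphisms of compact abelian groups are topologically conjugate here if there is a continuous group isomorphism intertwining the actions. Setting: a diagram $\mathcal D$ of $\ell$ has arcs $0,1,\dots,q$, arc $0$ lying on $\ell_1$; $x_i\in\pi$ is the Wirtinger meridian generator of arc $i$, and $\pi=\langle x_0,\dots,x_q\mid r_1,\dots,r_q\rangle$ is the Wirtinger presentation (one redundant relator omitted). At a crossing with overcrossing arc $i$ and left and right undercrossing arcs $j$, $k$ respectively, the relation is $x_ix_j=x_kx_i$. $\epsilon:\pi\to\mathbb Z^d$ is abelianization (each $\epsilon(x_i)$ is a standard basis vector); $\mathbf n=(n_1,\dots,n_d)\in\mathbb Z^d$ is identified with the monomial $t^{\mathbf n}=t_1^{n_1}\cdots t_d^{n_d}$, so $R[\mathbb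 Z^d]$ is a Laurent polynomial ring. Write $X_i=\gamma(x_i)$, and let $V=R^N$ (row vectors), a right $R[\pi]$-module via $\gamma$. Based $\gamma$-twisted Alexander module: $X$ is the exterior of $\ell$, collapsed to the 2-complex of the presentation (one $0$-cell $*$, $1$-cells $x_0,\dots,x_q$, $2$-cells $r_1,\dots,r_q$), $\tilde X$ its universal cover, $X'$ its universal abelian cover, $C_*(\tilde X)$ the cellular chain complex with coefficients in $R$. Set $C_*(X';V)=(R[\mathbb Z^d]\otimes_R V)\otimes_{R[\pi]}C_*(\tilde X)$, where $(p\otimes v)\cdot g=pt^{\epsilon(g)}\otimes v\gamma(g)$. Write $C_1(X';V)=W\oplus Y$ with $W$ spanned by the chains $1\otimes v\otimes x_0$ and $Y$ by the chains $1\otimes v\otimes x_i$, $1\le i\le q$, over $R[\mathbb Z^d]$, and let $b:C_2(X';V)\to Y$ be the $Y$-component of $\partial_2$. Then $\mathcal A^0_\gamma=\mathrm{coker}\, b$. Explicitly, it is the $R[\mathbb Z^d]$-module generated by $1\otimes v\otimes x_i$ (linear in $v\in V$) with relations $1\otimes v\otimes x_i+t^{\epsilon(x_i)}\otimes vX_i\otimes x_j=1\otimes v\otimes x_k+t^{\epsilon(x_k)}\otimes vX_k\otimes x_i$ for each Wirtinger relator, where terms involving $x_0$ are set equal to $0$. Coloring system: let $\hat R=\mathrm{Hom}(R,\mathbb T)$. A based $\gamma$-twisted dynamical coloring of $\mathcal D$ assigns to each arc $i$ an element $\alpha_i=(\alpha_{i,\mathbf n})\in(\hat R^N)^{\mathbb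 Z^d}$ (column vectors in $\hat R^N$), with $\alpha_0=0$, such that at each crossing, with overcrossing arc $i$ and left and right undercrossing arcs $j$, $k$ respectively, $\alpha_{i,\mathbf n}+X_i\alpha_{j,\mathbf n+\epsilon(x_i)}=\alpha_{k,\mathbf n}+X_k\alpha_{i,\mathbf n+\epsilon(x_k)}$ for all $\mathbf n\in\mathbb Z^d$. The compact group of all such colorings is $\mathrm{Col}^0_\gamma(\ell)$, with $\mathbb Z^d$-action $\sigma=(\sigma_{\mathbf m})$ given by the shift $(\sigma_{\mathbf m}\alpha)_{i,\mathbf n}=\alpha_{i,\mathbf n+\mathbf m}$. *)

(* Defs.v *)
From HB Require Import structures.
From mathcomp Require Import all_boot all_order all_algebra finmap.
From mathcomp.multinomials Require Import monalg.
From mathcomp Require Import all_classical all_reals all_analysis.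

Set Implicit Arguments.
Unset Strict Implicit.
Unset Printing Implicit Defensive.

Import Order.TTheory GRing.Theory Num.Theory.
Import numFieldNormedType.Exports.

Local Open Scope fset_scope.
Local Open Scope ring_scope.

(** * Laurent polynomials *)

(* The group ring [R[Z^d]].  Its additive group is the library's type of
   finitely supported functions; the product of [monalg] is not available,
   because [monomType] excludes monoids with nontrivial units. *)
Definition laurent (R : comNzRingType) (d : nat) : Type := {malg R['rV[int]_d]}.

HB.instance Definition _ (R : comNzRingType) (d : nat) :=
  GRing.Zmodule.on (laurent R d).

Definition laurent_monomial (R : comNzRingType) (d : nat) (c : R)
  (n : 'rV[int]_d) : laurent R d := << c *g n >>.

HB.lock Definition laurent_mul (R : comNzRingType) (d : nat)
    (p q : laurent R d) : laurent R d :=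
  \sum_(m <- msupp p) \sum_(n <- msupp q)
    laurent_monomial (p@_m * q@_n) (m + n).

Section Laurent.
Variables (R : comNzRingType) (d : nat).
Local Notation L := (laurent R d).
Local Notation laurent_monomial := (@laurent_monomial R d).
Local Notation laurent_mul := (@laurent_mul R d).

Definition laurent_one : L := laurent_monomial 1 0.

Lemma laurent_mulw (d1 d2 : {fset 'rV[int]_d}) (p q : L) :
  msupp p `<=` d1 -> msupp q `<=` d2 ->
  laurent_mul p q =
  \sum_(m <- d1) \sum_(n <- d2) laurent_monomial (p@_m * q@_n) (m + n).
Proof.
move=> le1 le2; rewrite laurent_mul.unlock (big_fset_incl _ le1) /=.
  apply: eq_bigr => m _; apply: big_fset_incl => // n _ /mcoeff_outdom ->.
  by rewrite mulr0 /laurent_monomial monalgU0.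
move=> m _ /mcoeff_outdom pm; rewrite big1 // => n _.
by rewrite pm mul0r /laurent_monomial monalgU0.
Qed.

Lemma laurent_mulC : commutative laurent_mul.
Proof.
move=> p q; rewrite !laurent_mul.unlock exchange_big /=.
by apply: eq_bigr => n _; apply: eq_bigr => m _; rewrite mulrC addrC.
Qed.

Lemma laurent_mul0 (p : L) : laurent_mul 0 p = 0.
Proof. by rewrite laurent_mul.unlock msupp0 big_seq_fset0. Qed.

Lemma laurent_mulDl : left_distributive laurent_mul +%R.
Proof.
move=> p q r.
rewrite [in RHS](laurent_mulw (fsubsetUl _ (msupp q)) (fsubset_refl _)).
rewrite [in RHS](laurent_mulw (fsubsetUr (msupp p) _) (fsubset_refl _)).
rewrite (laurent_mulw (msuppD_le _ _) (fsubset_refl _)).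
rewrite -big_split /=; apply: eq_bigr => m _.
rewrite -big_split /=; apply: eq_bigr => n _.
by rewrite mcoeffD mulrDl /laurent_monomial monalgUD.
Qed.

Lemma laurent_mulDr : right_distributive laurent_mul +%R.
Proof. by move=> p q r; rewrite !(laurent_mulC p) laurent_mulDl. Qed.

Lemma laurent_mulUU a b m n :
  laurent_mul (laurent_monomial a m) (laurent_monomial b n) =
  laurent_monomial (a * b) (m + n).
Proof.
rewrite (laurent_mulw msuppU_le msuppU_le) !big_seq_fset1.
by rewrite /laurent_monomial !mcoeffUU.
Qed.

Lemma laurentE (p : L) : p = \sum_(m <- msupp p) laurent_monomial p@_m m.
Proof. exact: monalgE. Qed.

Lemma laurent_mul_suml (I : Type) (s : seq I) (F : I -> L) (q : L) :
  laurent_mul (\sum_(i <- s) F i) q = \sum_(i <- s) laurent_mul (F i) q.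
Proof.
exact: (big_morph (laurent_mul^~ q)
          (fun a b => laurent_mulDl a b q) (laurent_mul0 q)).
Qed.

Lemma laurent_mul_sumr (I : Type) (s : seq I) (F : I -> L) (q : L) :
  laurent_mul q (\sum_(i <- s) F i) = \sum_(i <- s) laurent_mul q (F i).
Proof.
rewrite laurent_mulC laurent_mul_suml.
by apply: eq_bigr => i _; rewrite laurent_mulC.
Qed.

Lemma laurent_mulA : associative laurent_mul.
Proof.
move=> p q r; rewrite (laurentE p) !laurent_mul_suml; apply: eq_bigr => i _.
rewrite (laurentE q) !(laurent_mul_suml, laurent_mul_sumr).
apply: eq_bigr => j _.
rewrite (laurentE r) !laurent_mul_sumr; apply: eq_bigr => k _.
by rewrite !laurent_mulUU mulrA addrA.
Qed.

Lemma laurent_mul1 : left_id laurent_one laurent_mul.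
Proof.
move=> p; rewrite [in LHS](laurentE p) laurent_mul_sumr [RHS]laurentE.
by apply: eq_bigr => m _; rewrite laurent_mulUU mul1r add0r.
Qed.

Lemma laurent_one_neq0 : laurent_one != 0.
Proof. by rewrite /laurent_one /laurent_monomial monalgU_eq0 oner_eq0. Qed.

HB.instance Definition _ := GRing.Zmodule_isComNzRing.Build L
  laurent_mulA laurent_mulC laurent_mul1 laurent_mulDl laurent_one_neq0.

End Laurent.

Definition laurent_const (R : comNzRingType) (d : nat) (c : R) : laurent R d :=
  laurent_monomial c 0.

Definition tpow (R : comNzRingType) (d : nat) (n : 'rV[int]_d) : laurent R d :=
  laurent_monomial 1 n.

(** * Cokernels of module homomorphisms *)

Section Cokernel.
Variables (A : comNzRingType) (U V : lmodType A) (f : {linear U -> V}).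

Definition im_pred : {pred V} := fun y => `[< exists x, f x = y >].

Lemma im_zmod_closed : zmod_closed im_pred.
Proof.
split=> [|y z]; first by apply/asboolP; exists 0; rewrite linear0.
move=> /asboolP[u <-] /asboolP[v <-].
by apply/asboolP; exists (u - v); rewrite linearB.
Qed.
HB.instance Definition _ := GRing.isZmodClosed.Build V im_pred im_zmod_closed.

Definition coker : Type := Quotient.quot im_pred.

HB.instance Definition _ := GRing.Zmodule.on coker.

Definition coker_pi (y : V) : coker := (\pi_(Quotient.quot im_pred) y)%qT.

Definition coker_repr (c : coker) : V := repr (c : Quotient.quot im_pred).

Lemma coker_reprK c : coker_pi (coker_repr c) = c.
Proof. exact: (@reprK _ (Quotient.quot im_pred)). Qed.

Definition coker_scale (a : A) (c : coker) : coker :=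
  coker_pi (a *: coker_repr c).

Lemma coker_pi_eq y z : (coker_pi y = coker_pi z) <-> exists x, f x = y - z.
Proof.
split=> [/eqP|h]; first by rewrite -Quotient.idealrBE => /asboolP.
by apply/eqP; rewrite -Quotient.idealrBE; apply/asboolP.
Qed.

Lemma coker_piD y z : coker_pi (y + z) = coker_pi y + coker_pi z.
Proof. exact: Quotient.pi_add. Qed.

Lemma coker_piZ a y : coker_scale a (coker_pi y) = coker_pi (a *: y).
Proof.
apply/coker_pi_eq; rewrite -scalerBr.
have /coker_pi_eq[x xE] := coker_reprK (coker_pi y).
by exists (a *: x); rewrite linearZ /= xE.
Qed.

Lemma coker_scaleA a b c :
  coker_scale a (coker_scale b c) = coker_scale (a * b) c.
Proof.
rewrite -(coker_reprK c).
by rewrite !coker_piZ scalerA.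
Qed.

Lemma coker_scale1 : left_id 1 coker_scale.
Proof. by move=> c; rewrite /coker_scale scale1r coker_reprK. Qed.

Lemma coker_scaleDr : right_distributive coker_scale +%R.
Proof.
move=> a b c; rewrite -(coker_reprK b).
rewrite -(coker_reprK c).
by rewrite -coker_piD !coker_piZ scalerDr coker_piD.
Qed.

Lemma coker_scaleDl c : {morph coker_scale^~ c : a b / a + b}.
Proof. by move=> a b; rewrite /coker_scale scalerDl coker_piD. Qed.

HB.instance Definition _ := GRing.Zmodule_isLmodule.Build A coker
  coker_scaleA coker_scale1 coker_scaleDr coker_scaleDl.

End Cokernel.

(** * Pontryagin duality *)

Section Circle.
Variable K : realType.

Definition int_pred : {pred K} := fun r => r \is a Num.int.

Lemma int_pred_zmod_closed : zmod_closed int_pred.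
Proof. by split=> [|r s]; [exact: rpred0 | exact: rpredB]. Qed.
HB.instance Definition _ :=
  GRing.isZmodClosed.Build K int_pred int_pred_zmod_closed.

(* [R/Z] with the quotient topology. *)
Definition circle : Type := quotient_topology (Quotient.quot int_pred).

HB.instance Definition _ := Topological.on circle.
HB.instance Definition _ :=
  GRing.Zmodule.copy circle (Quotient.quot int_pred).

End Circle.

Section Dual.
Variables (K : realType) (M : zmodType).

Definition character_pred : {pred M -> circle K} :=
  fun f => `[< zmod_morphism f >].

Lemma character_zmod_closed : zmod_closed character_pred.
Proof.
split=> [|f g]; first by apply/asboolP => x y; rewrite subr0.
move=> /asboolP fB /asboolP gB; apply/asboolP => x y.
by rewrite !fctE fB gB [in LHS]opprD addrACA -opprD.
Qed.
HB.instance Definition _ :=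
  GRing.isZmodClosed.Build (M -> circle K) character_pred character_zmod_closed.

Record pontryagin_dual : Type := Dual {
  dual_fun :> M -> circle K;
  dual_funP : dual_fun \in character_pred }.

HB.instance Definition _ := [isSub for dual_fun].
HB.instance Definition _ := [Choice of pontryagin_dual by <:].
HB.instance Definition _ := [SubChoice_isSubZmodule of pontryagin_dual by <:].

(* [M] is discrete, so that the compact-open topology on its dual is that of
   pointwise convergence. *)
HB.instance Definition _ := Topological.copy pontryagin_dual
  (initial_topology (dual_fun : pontryagin_dual -> {ptws M -> circle K})).

End Dual.

Section DualMap.
Variables (K : realType) (M N : zmodType) (f : {additive M -> N}).

Lemma dual_map_subproof (chi : pontryagin_dual K N) :
  chi \o f \in @character_pred K M.
Proof.
apply/asboolP => x y /=; rewrite raddfB.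
by case: chi => chi /= /asboolP ->.
Qed.

Definition dual_map (chi : pontryagin_dual K N) : pontryagin_dual K M :=
  Dual (dual_map_subproof chi).

End DualMap.

(* A matrix acts on column vectors over the dual of the ring, [R] acting on its
   dual by [(r chi)(s) = chi (r s)]. *)
Definition dual_mulmx (K : realType) (R : comNzRingType) (N : nat)
    (A : 'M[R]_N) (a : 'cV[pontryagin_dual K R]_N) :
    'cV[pontryagin_dual K R]_N :=
  \col_i \sum_(j < N) dual_map (A i j \*o @idfun R) (a j 0).

(* The two topological groups are related by a continuous isomorphism which
   intertwines the actions of [Z^d]. *)
Definition topologically_conjugate (d : nat)
    (A B : PreTopologicalZmodule.type)
    (s : 'rV[int]_d -> A -> A) (t : 'rV[int]_d -> B -> B) : Prop :=
  exists f : {additive A -> B}, [/\ bijective f, continuous f &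
    forall n a, f (s n a) = t n (f a)].

(** * Groups given by generators and relations *)

(* Relations [u = v] between positive words; these suffice for Wirtinger
   presentations. *)
Definition word_value (I : Type) (G : groupType) (x : I -> G) (w : seq I) : G :=
  (\prod_(i <- w) x i)%g.

Definition satisfies (I J : Type) (G : groupType) (x : I -> G)
    (rel : J -> seq I * seq I) : Prop :=
  forall c, word_value x (rel c).1 = word_value x (rel c).2.

(* The universal property of [<I | rel>]. *)
Definition presented_by (I J : Type) (G : groupType) (x : I -> G)
    (rel : J -> seq I * seq I) : Prop :=
  satisfies x rel /\
  forall (H : groupType) (y : I -> H), satisfies y rel ->
    exists! f : G -> H,
      {morph f : g h / (g * h)%g >-> (g * h)%g} /\ (forall i, f (x i) = y i).

(** * Link diagrams *)

(* An oriented diagram on the sphere, as a four-valent combinatorial map.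
   Each of the [n] crossings has four darts, numbered counterclockwise
   starting from the incoming end of the understrand: the understrand goes from
   0 to 2, and the overstrand from 3 to 1 at a positive crossing and from 1 to
   3 at a negative one. *)
Definition dart (n : nat) : finType := ('I_n * 'I_4)%type.

Definition turn (n : nat) (k : nat) (x : dart n) : dart n :=
  (x.1, inord ((x.2 + k) %% 4)%N).

Definition outgoing (n : nat) (positive : 'I_n -> bool) (x : dart n) : bool :=
  ((x.2 : nat) == 2)%N || ((x.2 : nat) == if positive x.1 then 1 else 3)%N.

(* Here and below, [mate] exchanges the two ends of each edge of the diagram;
   the faces are the orbits of [face_next]. *)
Definition face_next (n : nat) (mate : dart n -> dart n) (x : dart n) :
    dart n :=
  turn 1 (mate x).

Definition same_piece (n : nat) (mate : dart n -> dart n) : rel (dart n) :=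
  fun x y => (y == mate x) || (y == turn 1 x).

Definition same_arc (n : nat) (mate : dart n -> dart n) : rel (dart n) :=
  fun x y => (y == mate x) || (odd x.2 && (y == turn 2 x)).

Definition same_strand (n : nat) (mate : dart n -> dart n) : rel (dart n) :=
  fun x y => (y == mate x) || (y == turn 2 x).

(* A diagram of a [d.+1]-component link with as many crossings as arcs, i.e.
   such that every component passes under some crossing.  [diagram_planar] is
   Euler's formula V + F = E + 2 (number of pieces), which says that each
   connected piece of the diagram lies on a sphere. *)
Record link_diagram (q d : nat) := LinkDiagram {
  positive : 'I_q.+1 -> bool;
  mate : dart q.+1 -> dart q.+1;
  mateK : involutive mate;
  mate_outgoing : forall x, outgoing positive (mate x) = ~~ outgoing positive x;
  diagram_planar :
    (q.+1 + fcard (face_next mate) predT =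
     2 * q.+1 + 2 * n_comp (same_piece mate) predT)%N;
  arc_of : dart q.+1 -> 'I_q.+1;
  arc_surj : forall i, exists x, arc_of x = i;
  arcP : forall x y, arc_of x = arc_of y <-> connect (same_arc mate) x y;
  component_of : 'I_q.+1 -> 'I_d.+1;
  component_surj : forall k, exists i, component_of i = k;
  componentP : forall x y,
    component_of (arc_of x) = component_of (arc_of y) <->
    connect (same_strand mate) x y;
  component_arc0 : component_of ord0 = ord0 }.

Section Wirtinger.
Variables (q d : nat) (D : link_diagram q d).

(* The sides of the overstrand, which at a positive crossing has the outgoing
   end of the understrand on its left. *)
Definition over_arc (c : 'I_q.+1) : 'I_q.+1 := arc_of D (c, inord 1).
Definition left_arc (c : 'I_q.+1) : 'I_q.+1 :=
  arc_of D (c, if positive D c then inord 2 else inord 0).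
Definition right_arc (c : 'I_q.+1) : 'I_q.+1 :=
  arc_of D (c, if positive D c then inord 0 else inord 2).

Definition wirtinger_relator (c : 'I_q.+1) : seq 'I_q.+1 * seq 'I_q.+1 :=
  ([:: over_arc c; left_arc c], [:: right_arc c; over_arc c]).

(* [pi] is the link group, generated by the meridians [x] of the arcs subject
   to the Wirtinger relators, among which that of the crossing [c0] is
   redundant. *)
Definition wirtinger_presentation (c0 : 'I_q.+1) (pi : groupType)
    (x : 'I_q.+1 -> pi) : Prop :=
  presented_by x wirtinger_relator /\
  presented_by x (fun c : 'I_q => wirtinger_relator (lift c0 c)).

(* These conditions determine [eps], since the [x i] generate [pi]. *)
Definition abelianization (pi : groupType) (x : 'I_q.+1 -> pi)
    (eps : pi -> 'rV[int]_d.+1) : Prop :=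
  {morph eps : g h / (g * h)%g >-> g + h} /\
  forall i, eps (x i) = delta_mx 0 (component_of D i).

End Wirtinger.

Definition representation (R : comUnitRingType) (N : nat) (pi : groupType)
    (gamma : pi -> 'M[R]_N) : Prop :=
  [/\ forall g, gamma g \in unitmx, gamma 1%g = 1%:M &
      {morph gamma : g h / (g * h)%g >-> g *m h}].

(** * The based twisted Alexander module *)

Section TwistedChains.
Variables (A : comNzRingType) (N q d : nat) (D : link_diagram q d).
Variables (c0 : 'I_q.+1) (pi : groupType) (x : 'I_q.+1 -> pi).
Variable tau : pi -> 'M[A]_N.

(* The coefficients are the row vectors over [A], on which [pi] acts on the
   right through [tau].  A 1-chain [sum_i u_i (x) x_i] is the matrix with rows
   [u_i], and a 2-chain [sum_c u_c (x) r_c], for [c] other than [c0], the one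
   with rows [u_c].  [path_chain w u] is [u (x) w~], with [w~] the lift starting
   at the base point of the edge path spelled by [w]. *)
Fixpoint path_chain (w : seq 'I_q.+1) (u : 'rV[A]_N) : 'M[A]_(q.+1, N) :=
  if w is i :: w' then
    delta_mx i (0 : 'I_1) *m u + path_chain w' (u *m tau (x i))
  else 0.

Definition boundary2 (z : 'M[A]_(q, N)) : 'M[A]_(q.+1, N) :=
  \sum_(c < q) (path_chain (wirtinger_relator D (lift c0 c)).1 (row c z) -
                path_chain (wirtinger_relator D (lift c0 c)).2 (row c z)).

(* The component of the boundary along the chains [u (x) x_i], [1 <= i]. *)
Definition based_boundary (z : 'M[A]_(q, N)) : 'M[A]_(q, N) :=
  row' ord0 (boundary2 z).

Lemma path_chain_linear w : linear (path_chain w).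
Proof.
elim: w => [|i w IHw] a u v /=; first by rewrite scaler0 addr0.
rewrite mulmxDl -scalemxAl IHw mulmxDr -scalemxAr scalerDr.
by rewrite addrACA.
Qed.

#[local] Arguments path_chain : simpl never.

Lemma boundary2_linear : linear boundary2.
Proof.
move=> a y z; rewrite /boundary2 scaler_sumr -big_split /=.
apply: eq_bigr => c _; rewrite [row c _]linearP.
by rewrite !path_chain_linear scalerBr opprD addrACA.
Qed.

Lemma based_boundary_linear : linear based_boundary.
Proof.
move=> a y z; rewrite /based_boundary boundary2_linear.
by apply/matrixP => i j; rewrite !mxE.
Qed.

HB.instance Definition _ :=
  GRing.isLinear.Build A 'M[A]_(q, N) 'M[A]_(q, N) _ based_boundary
    based_boundary_linear.

End TwistedChains.

(* The action of [g] on [R[Z^d] (x) V], the row vectors over [R[Z^d]]: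
   [(p (x) v) g = p t^(eps g) (x) v gamma(g)]. *)
Definition twisted_rep (R : comNzRingType) (N d : nat) (pi : groupType)
    (eps : pi -> 'rV[int]_d) (gamma : pi -> 'M[R]_N) (g : pi) :
    'M[laurent R d]_N :=
  tpow R (eps g) *: map_mx (@laurent_const R d) (gamma g).

Definition twisted_alexander (R : comNzRingType) (N q d : nat)
    (D : link_diagram q d) (c0 : 'I_q.+1) (pi : groupType)
    (x : 'I_q.+1 -> pi) (eps : pi -> 'rV[int]_d.+1) (gamma : pi -> 'M[R]_N) :
    lmodType (laurent R d.+1) :=
  coker (based_boundary D c0 x (twisted_rep eps gamma)).

Definition dual_action (K : realType) (R : comNzRingType) (d : nat)
    (M : lmodType (laurent R d)) (n : 'rV[int]_d) :
    pontryagin_dual K M -> pontryagin_dual K M :=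
  dual_map ( *:%R (tpow R n)).

Arguments dual_action K {R d} M n.

(** * Based twisted dynamical colorings *)

Section Colorings.
Variables (K : realType) (R : comNzRingType) (N q d : nat).
Variables (D : link_diagram q d) (pi : groupType) (x : 'I_q.+1 -> pi).
Variables (eps : pi -> 'rV[int]_d.+1) (gamma : pi -> 'M[R]_N).

Local Notation config :=
  ('I_q.+1 -> 'rV[int]_d.+1 -> 'cV[pontryagin_dual K R]_N).

Definition crossing_equation (a : config) (c : 'I_q.+1) : Prop :=
  let i := over_arc D c in let j := left_arc D c in let k := right_arc D c in
  forall n, a i n + dual_mulmx (gamma (x i)) (a j (n + eps (x i))) =
            a k n + dual_mulmx (gamma (x k)) (a i (n + eps (x k))).

Definition coloring_pred : {pred config} := fun a =>
  `[< (forall n, a ord0 n = 0) /\ forall c, crossing_equation a c >].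

Lemma dual_mulmxB (A : 'M[R]_N) : {morph @dual_mulmx K R N A : a b / a - b}.
Proof.
move=> a b; apply/matrixP => i j; rewrite !mxE -sumrB; apply: eq_bigr => k _.
by rewrite !mxE; apply/val_inj/funext => s.
Qed.

Lemma coloring_zmod_closed : zmod_closed coloring_pred.
Proof.
split.
  apply/asboolP; split=> // c i j k n.
  have dm0 A : @dual_mulmx K R N A 0 = 0.
    by have := dual_mulmxB A 0 0; rewrite !subrr.
  have E i' n' : (0 : config) i' n' = 0 by [].
  by rewrite !E !dm0.
move=> a b /asboolP[a0 ac] /asboolP[b0 bc]; apply/asboolP.
have E i' n' : (a - b) i' n' = a i' n' - b i' n' by [].
split=> [n|c i j k n]; first by rewrite E a0 b0 subr0.
rewrite !E !dual_mulmxB addrACA -opprD.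
by rewrite [X in X - _]ac [X in _ - X]bc opprD addrACA.
Qed.
HB.instance Definition _ :=
  GRing.isZmodClosed.Build config coloring_pred coloring_zmod_closed.

Record coloring : Type := Coloring {
  coloring_fun :> config;
  coloring_funP : coloring_fun \in coloring_pred }.

HB.instance Definition _ := [isSub for coloring_fun].
HB.instance Definition _ := [Choice of coloring by <:].
HB.instance Definition _ := [SubChoice_isSubZmodule of coloring by <:].

(* A subspace of the product of copies of the column vectors over the dual of
   [R], themselves with the product topology. *)
HB.instance Definition _ := Topological.copy coloring
  (initial_topology (coloring_fun :
     coloring -> {ptws 'I_q.+1 ->
       {ptws 'rV[int]_d.+1 -> 'cV[pontryagin_dual K R]_N}})).

Lemma shift_subproof (m : 'rV[int]_d.+1) (a : coloring) :
  (fun i n => a i (n + m)) \in coloring_pred.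
Proof.
case: a => a /= /asboolP[a0 ac]; apply/asboolP; split=> // c i j k n.
by have := ac c (n + m); rewrite /= ![n + m + _]addrAC.
Qed.

Definition coloring_shift (m : 'rV[int]_d.+1) (a : coloring) : coloring :=
  Coloring (shift_subproof m a).

End Colorings.

Arguments coloring_shift K {R N q d} D { pi } x eps gamma m a.

(* Main.v *)
Require Import Defs.
From HB Require Import structures.
From mathcomp Require Import all_boot all_order all_algebra finmap.
From mathcomp.multinomials Require Import monalg.
From mathcomp Require Import all_classical all_reals all_analysis.

(** A 1-chain is a finite sum of elements [s t^n (x) e_k (x) x_i] with [s] in
    [R], so that a character of the discrete group of 1-chains is the same
    thing as an arbitrary family of characters of [R] indexed by [i], [n] and
    [k], that is, a configuration [alpha] ([character_coordsK],
    [chain_characterK]). The dual of the based Alexander module consists of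
    the characters which vanish on [W], i.e. [alpha_0 = 0], and on the
    boundaries of the 2-chains.

    The action of [g] on configurations, by the matrix [gamma g] and the
    shift by [eps g], is adjoint to the right action of [g] on [R[Z^d] (x) V]
    ([row_pairing_act]). Hence pairing [alpha] with the boundary of [u (x)
    r_c] amounts to pairing [u] with the difference of the Fox derivatives of
    the two sides of [r_c] along the derivation [x_i |-> alpha_i]
    ([chain_pairing_path]), and for a Wirtinger relator the equality of these
    derivatives is the crossing equation ([fox_crossing]).

    The chain complex only contains [q] of the [q + 1] relators, whereas a
    coloring satisfies an equation at every crossing. The missing one is
    automatic: the derivation is a lift of the generators to the semidirect
    product of [pi] with the group of configurations on one arc; since [q]
    relators present [pi], the lift extends to a homomorphism, which respects
    the last relator because that one holds in [pi] ([fox_presented]).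

    The bijection so obtained consists in reading off values of characters,
    so it is additive, continuous for pointwise convergence, and turns
    multiplication by monomials into the shift. *)

Set Implicit Arguments.
Unset Strict Implicit.
Unset Printing Implicit Defensive.

Import GRing.Theory.

Local Open Scope ring_scope.

(** * Continuity of maps into products *)

Lemma continuous_ptws (X Y : topologicalType) (I : Type)
    (f : X -> {ptws I -> Y}) :
  (forall i, continuous (fun x => f x i)) -> continuous f.
Proof.
move=> fc x; apply/cvg_sup => i.
exact: (@continuous_comp_initial _ _ _ (fun h : I -> Y => h i) f (fc i)).
Qed.

Lemma continuous_mx (X Y : topologicalType) (m n : nat)
    (f : X -> 'M[Y]_(m, n)) :
  (forall i j, continuous (fun x => f x i j)) -> continuous f.
Proof.
move=> fc x A [P Pnbhs sPA].
rewrite nbhs_filterE.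
apply: filterS (_ : nbhs x (fun y => forall i j, P i j (f y i j))).
  by move=> y Py; apply: sPA.
apply: filter_forall => i; apply: filter_forall => j.
exact: (fc i j x _ (Pnbhs i j)).
Qed.

(** * Characters of discrete groups *)

Section Characters.
Variable K : realType.

Lemma dualB (M : zmodType) (chi : pontryagin_dual K M) (s t : M) :
  chi (s - t) = chi s - chi t.
Proof. by case: chi => chi /= /asboolP. Qed.

Lemma dual0 (M : zmodType) (chi : pontryagin_dual K M) : chi 0 = 0.
Proof. by rewrite -(subrr 0) dualB subrr. Qed.

Lemma dualD (M : zmodType) (chi : pontryagin_dual K M) (s t : M) :
  chi (s + t) = chi s + chi t.
Proof. by rewrite -{1}[t]opprK dualB -[- t]sub0r dualB dual0 sub0r opprK. Qed.

Lemma dual_sum (M : zmodType) (chi : pontryagin_dual K M) (I : Type)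
    (r : seq I) (P : pred I) (F : I -> M) :
  chi (\sum_(i <- r | P i) F i) = \sum_(i <- r | P i) chi (F i).
Proof. exact: (big_morph chi (dualD chi) (dual0 chi)). Qed.

Lemma dual_ext (M : zmodType) (chi psi : pontryagin_dual K M) :
  (forall s, chi s = psi s) -> chi = psi.
Proof. by move=> e; apply/val_inj/funext. Qed.

Lemma dual_sumE (M : zmodType) (I : Type) (r : seq I) (P : pred I)
    (F : I -> pontryagin_dual K M) (s : M) :
  (\sum_(i <- r | P i) F i) s = \sum_(i <- r | P i) F i s.
Proof. exact: (big_morph (fun chi : pontryagin_dual K M => chi s)). Qed.

(** A character of a group descends to a quotient as soon as it kills the
    kernel: values on arbitrary preimages are then independent of choices. *)
Lemma dual_factor (M M' : zmodType) (p : {additive M -> M'})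
    (psi : pontryagin_dual K M) :
  (forall y, exists x, p x = y) -> (forall x, p x = 0 -> psi x = 0) ->
  exists chi : pontryagin_dual K M', dual_map p chi = psi.
Proof.
move=> /choice[s sK] psi0.
have psis x : psi (s (p x)) = psi x.
  by apply: subr0_eq; rewrite -dualB psi0 // raddfB sK subrr.
have chiB : (fun y => psi (s y)) \in @character_pred K M'.
  apply/asboolP => y z; rewrite -dualB -[RHS]psis.
  by rewrite [in RHS]raddfB !sK.
by exists (Dual chiB); apply: dual_ext => x /=; apply: psis.
Qed.

Lemma dual_eval_continuous (M : zmodType) (s : M) :
  continuous (fun chi : pontryagin_dual K M => chi s).
Proof.
have fun_cont : continuous
    (@dual_fun K M : pontryagin_dual K M -> {ptws M -> circle K}).
  exact: initial_continuous.
move=> chi; exact: (@cvg_comp _ _ _ (@dual_fun K M)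
  (fun h : M -> circle K => h s) _ _ _ (fun_cont chi)
  (@proj_continuous M (fun _ => circle K) s (dual_fun chi))).
Qed.

Lemma continuous_dual (X : topologicalType) (M : zmodType)
    (f : X -> pontryagin_dual K M) :
  (forall s, continuous (fun x => f x s)) -> continuous f.
Proof.
move=> fc; apply: (@continuous_comp_initial _ _ _
  (@dual_fun K M : _ -> {ptws M -> circle K})).
exact: continuous_ptws.
Qed.

End Characters.

(** * Semidirect products and Fox derivatives *)

Section Semidirect.
Variables (G : groupType) (P : zmodType) (act : G -> P -> P).

Definition group_module : Prop :=
  [/\ forall g, zmod_morphism (act g), forall a, act 1%g a = a &
      forall g h a, act (g * h)%g a = act g (act h a)].

(** The proof that [act] is an action by automorphisms is an argument of the
    type, so that the group structure can be found from the type alone. *)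
Definition semidirect (_ : group_module) : Type := (G * P)%type.

Variable actP : group_module.

HB.instance Definition _ := Choice.on (semidirect actP).

Lemma module_act0 g : act g 0 = 0.
Proof. by have [actB _ _] := actP; rewrite -{1}(subrr 0) actB subrr. Qed.

Lemma module_actN g a : act g (- a) = - act g a.
Proof. by have [actB _ _] := actP; rewrite -sub0r actB module_act0 sub0r. Qed.

Lemma module_actD g a b : act g (a + b) = act g a + act g b.
Proof.
by have [actB _ _] := actP; rewrite -{1}[b]opprK actB module_actN opprK.
Qed.

Definition semidirect_one : semidirect actP := (1%g, 0).
Definition semidirect_inv (u : semidirect actP) : semidirect actP :=
  (u.1^-1%g, - act u.1^-1%g u.2).
Definition semidirect_mul (u v : semidirect actP) : semidirect actP :=
  ((u.1 * v.1)%g, u.2 + act u.1 v.2).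

Lemma semidirect_mulA : associative semidirect_mul.
Proof.
have [_ _ actM] := actP; move=> u v w.
by rewrite /semidirect_mul /= mulgA actM module_actD addrA.
Qed.

Lemma semidirect_mul1 : left_id semidirect_one semidirect_mul.
Proof.
have [_ act1 _] := actP; move=> [g a].
by rewrite /semidirect_mul /= mul1g act1 add0r.
Qed.

Lemma semidirect_mulr1 : right_id semidirect_one semidirect_mul.
Proof. by move=> [g a]; rewrite /semidirect_mul /= mulg1 module_act0 addr0. Qed.

Lemma semidirect_mulV :
  left_inverse semidirect_one semidirect_inv semidirect_mul.
Proof. by move=> [g a]; rewrite /semidirect_mul /= mulVg addNr. Qed.

Lemma semidirect_mulrV :
  right_inverse semidirect_one semidirect_inv semidirect_mul.
Proof.
have [_ act1 actM] := actP; move=> [g a].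
by rewrite /semidirect_mul /= mulgV module_actN -actM mulgV act1 subrr.
Qed.

HB.instance Definition _ := isGroup.Build (semidirect actP)
  semidirect_mulA semidirect_mul1 semidirect_mulr1
  semidirect_mulV semidirect_mulrV.

Variables (I : Type) (x : I -> G) (a : I -> P).

(** The Fox derivative of a word, or rather its value in a module: the
    derivation along [x] which takes the value [a i] on the letter [i]. *)
Fixpoint fox (w : seq I) : P :=
  if w is i :: w' then a i + act (x i) (fox w') else 0.

(** A derivation is the same as a lift to the semidirect product: the product
    of the letters [(x i, a i)] carries the Fox derivative along. *)
Lemma word_value_semidirect w :
  word_value (fun i => (x i, a i) : semidirect actP) w =
  (word_value x w, fox w).
Proof.
rewrite /word_value; elim: w => [|i w IHw]; first by rewrite !big_nil.
by rewrite !big_cons IHw.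
Qed.

(** A derivation defined on generators which respects a set of defining
    relators respects every relator that holds in the group, since by the
    universal property the lift [i |-> (x i, a i)] extends to a homomorphism
    from [G] to the semidirect product. This recovers the equation at the
    crossing whose relator is left out of the presentation. *)
Lemma fox_presented (J J' : Type) (rel : J -> seq I * seq I)
    (rel' : J' -> seq I * seq I) :
  satisfies x rel -> presented_by x rel' ->
  (forall c, fox (rel' c).1 = fox (rel' c).2) ->
  forall c, fox (rel c).1 = fox (rel c).2.
Proof.
move=> xrel [xrel' univ] foxE c.
pose y i : semidirect actP := (x i, a i).
have [|f [[fM fx] _]] := univ _ y.
  by move=> c'; rewrite !word_value_semidirect xrel' foxE.
have f1 : f 1%g = 1%g.
  by apply: (@mulgI _ (f 1%g)); rewrite -fM !mulg1.
have fw w : f (word_value x w) = word_value y w.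
  rewrite /word_value (big_morph f fM f1).
  by apply: eq_bigr.
have /(congr1 f) := xrel c.
by rewrite !fw !word_value_semidirect => -[].
Qed.

End Semidirect.

(** * Rows over the Laurent polynomials *)

Section Rows.
Variables (R : comNzRingType) (d N : nat).
Local Notation L := (laurent R d).

(** [monomial_row s n k] is the element [s t^n (x) e_k] of [R[Z^d] (x) V];
    these generate the row vectors additively. *)
Definition monomial_row (s : R) (n : 'rV[int]_d) (k : 'I_N) : 'rV[L]_N :=
  laurent_monomial s n *: delta_mx 0 k.

Lemma laurent_monomialB (s t : R) (n : 'rV[int]_d) :
  laurent_monomial (s - t) n = laurent_monomial s n - laurent_monomial t n.
Proof. exact: monalgUB. Qed.

Lemma laurent_monomialM (s t : R) (m n : 'rV[int]_d) :
  laurent_monomial s m * laurent_monomial t n =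
  laurent_monomial (s * t) (m + n).
Proof. exact: laurent_mulUU. Qed.

Lemma monomial_rowB (s t : R) n k :
  monomial_row (s - t) n k = monomial_row s n k - monomial_row t n k.
Proof. by rewrite /monomial_row laurent_monomialB scalerBl. Qed.

Lemma tpow_monomial_row (m : 'rV[int]_d) (s : R) n k :
  tpow R m *: monomial_row s n k = monomial_row s (n + m) k.
Proof. by rewrite scalerA laurent_monomialM mul1r [m + n]addrC. Qed.

Lemma row_monomialE (u : 'rV[L]_N) :
  u = \sum_(k < N) \sum_(n <- msupp (u 0 k)) monomial_row (u 0 k)@_n n k.
Proof.
rewrite [LHS]row_sum_delta; apply: eq_bigr => k _.
by rewrite -scaler_suml -laurentE.
Qed.

Lemma monomial_row_ext (V : zmodType) (f g : 'rV[L]_N -> V) :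
  {morph f : u v / u + v} -> {morph g : u v / u + v} -> f 0 = 0 -> g 0 = 0 ->
  (forall s n k, f (monomial_row s n k) = g (monomial_row s n k)) ->
  f =1 g.
Proof.
move=> fD gD f0 g0 fg u.
rewrite [u]row_monomialE.
rewrite (big_morph f fD f0) (big_morph g gD g0); apply: eq_bigr => k _.
by rewrite (big_morph f fD f0) (big_morph g gD g0); apply: eq_bigr.
Qed.

Lemma monomial_row_twisted (G : groupType) (eps : G -> 'rV[int]_d)
    (gamma : G -> 'M[R]_N) (g : G) (s : R) (n : 'rV[int]_d) (k : 'I_N) :
  monomial_row s n k *m twisted_rep eps gamma g =
  \sum_(l < N) monomial_row (gamma g k l * s) (n + eps g) l.
Proof.
rewrite [LHS]row_sum_delta; apply: eq_bigr => l _; congr (_ *: _).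
rewrite -scalemxAl -rowE !mxE /laurent_const /tpow !laurent_monomialM.
by rewrite mul1r mulrC addr0.
Qed.

End Rows.

(** * Pairing rows with doubly indexed characters *)

Section RowPairing.
Variables (K : realType) (R : comNzRingType) (d N : nat).
Local Notation L := (laurent R d).
Local Notation coeff := ('rV[int]_d -> 'cV[pontryagin_dual K R]_N).

(** The character of [R[Z^d] (x) V] whose restriction to the copy of [R] at
    [t^n (x) e_k] is the entry [k] of [a n]. *)
Definition row_pairing (a : coeff) (u : 'rV[L]_N) : circle K :=
  \sum_(k < N) \sum_(n <- msupp (u 0 k)) a n k 0 (u 0 k)@_n.

(** Additivity needs a common support for the rows to be added. *)
Lemma row_pairing_suppE (a : coeff) (u : 'rV[L]_N)
    (r : 'I_N -> {fset 'rV[int]_d}) :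
  (forall k, msupp (u 0 k) `<=` r k)%fset ->
  row_pairing a u = \sum_(k < N) \sum_(n <- r k) a n k 0 (u 0 k)@_n.
Proof.
move=> ur; apply: eq_bigr => k _; apply: big_fset_incl => // n _.
by move=> /mcoeff_outdom ->; rewrite dual0.
Qed.

Lemma row_pairingD (a : coeff) : {morph row_pairing a : u v / u + v}.
Proof.
move=> u v.
pose r k := (msupp (u 0 k) `|` msupp (v 0 k))%fset.
rewrite (@row_pairing_suppE _ (u + v) r); last first.
  by move=> k; rewrite mxE; apply: msuppD_le.
rewrite (@row_pairing_suppE _ u r); last by move=> k; apply: fsubsetUl.
rewrite (@row_pairing_suppE _ v r); last by move=> k; apply: fsubsetUr.
rewrite -big_split; apply: eq_bigr => k _.
rewrite -big_split; apply: eq_bigr => n _.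
by rewrite mxE mcoeffD dualD.
Qed.

Lemma row_pairing0 (a : coeff) : row_pairing a 0 = 0.
Proof.
by apply: big1 => k _; rewrite mxE msupp0 big_seq_fset0.
Qed.

Lemma row_pairing_monomial (a : coeff) s n k :
  row_pairing a (monomial_row s n k) = a n k 0 s.
Proof.
pose r (k' : 'I_N) := [fset n]%fset.
rewrite (@row_pairing_suppE _ _ r) /r.
  under eq_bigr do rewrite big_seq_fset1 !mxE eqxx /=.
  rewrite (bigD1 k) //= eqxx mulr1 mcoeffUU big1 ?addr0 // => k' /negPf k'k.
  by rewrite k'k mulr0 mcoeff0 dual0.
move=> k'; rewrite !mxE eqxx /= mulr_natr mulrb.
by case: ifP => _; rewrite ?msuppU_le // msupp0 fsub0set.
Qed.

Lemma row_pairing_coeffD (a b : coeff) u :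
  row_pairing (a + b) u = row_pairing a u + row_pairing b u.
Proof.
rewrite -big_split; apply: eq_bigr => k _.
rewrite -big_split; apply: eq_bigr => n _.
by rewrite -[(a + b) n]/(a n + b n) mxE.
Qed.

Lemma row_pairing_coeff0 u : row_pairing 0 u = 0.
Proof.
by apply: big1 => k _; apply: big1 => n _; rewrite -[(0 : coeff) n]/0 mxE.
Qed.

Lemma row_pairing_inj (a b : coeff) : row_pairing a =1 row_pairing b -> a = b.
Proof.
move=> ab; apply/funext => n; apply/matrixP => k j; rewrite ord1.
by apply: dual_ext => s; rewrite -!row_pairing_monomial ab.
Qed.

End RowPairing.

Section TwistedAction.
Variables (K : realType) (R : comUnitRingType) (d N : nat).
Variables (G : groupType) (eps : G -> 'rV[int]_d) (gamma : G -> 'M[R]_N).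
Local Notation coeff := ('rV[int]_d -> 'cV[pontryagin_dual K R]_N).

(** The left action of [G] on sequences of column vectors which appears in the
    crossing equations: matrix multiplication combined with a shift. *)
Definition dual_act (g : G) (a : coeff) : coeff :=
  fun n => dual_mulmx (gamma g) (a (n + eps g)).

(** The action on sequences of characters is adjoint to the twisted right
    action on [R[Z^d] (x) V]. This is why the Wirtinger relations of the
    Alexander module turn into the crossing equations. *)
Lemma row_pairing_act (g : G) (a : coeff) u :
  row_pairing (dual_act g a) u =
  row_pairing a (u *m twisted_rep eps gamma g).
Proof.
move: u; apply: monomial_row_ext.
- exact: row_pairingD.
- by move=> u v; rewrite mulmxDl row_pairingD.
- exact: row_pairing0.
- by rewrite mul0mx row_pairing0.
move=> s n k; rewrite row_pairing_monomial monomial_row_twisted mxE dual_sumE.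
rewrite (big_morph _ (row_pairingD a) (row_pairing0 a)).
by apply: eq_bigr => l _; rewrite row_pairing_monomial.
Qed.

Lemma dual_act_module :
  {morph eps : g h / (g * h)%g >-> g + h} -> representation gamma ->
  group_module dual_act.
Proof.
move=> epsM [_ gamma1 gammaM].
have dmE A (a : 'cV[pontryagin_dual K R]_N) k s :
    dual_mulmx A a k 0 s = \sum_(l < N) a l 0 (A k l * s).
  by rewrite mxE dual_sumE.
split=> [g a b|a|g h a]; apply/funext => n.
- exact: dual_mulmxB.
- have eps1 : eps 1%g = 0.
    by apply: (addrI (eps 1%g)); rewrite -epsM mulg1 addr0.
  rewrite /dual_act eps1 addr0 gamma1; apply/matrixP => k j; rewrite ord1.
  apply: dual_ext => s; rewrite dmE (bigD1 k) //= big1 ?addr0.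
    by rewrite mxE eqxx mul1r.
  by move=> l /negPf lk; rewrite mxE eq_sym lk mul0r dual0.
rewrite /dual_act epsM gammaM -addrA; apply/matrixP => k j; rewrite ord1.
apply: dual_ext => s; rewrite !dmE.
under [RHS]eq_bigr do rewrite dmE.
rewrite exchange_big /=; apply: eq_bigr => l _.
rewrite mxE mulr_suml dual_sum; apply: eq_bigr => m _.
by rewrite mulrCA mulrA.
Qed.

End TwistedAction.

(** * Characters of the twisted chains *)

Lemma row_delta_mul (A : pzRingType) (m n : nat) (i j : 'I_m) (u : 'rV[A]_n) :
  row j (delta_mx i (0 : 'I_1) *m u) = if j == i then u else 0.
Proof.
apply/rowP => k; rewrite !mxE big_ord1 !mxE eqxx andbT.
by case: (j == i); rewrite ?mul1r // mxE mul0r.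
Qed.

Section ChainPairing.
Variables (K : realType) (R : comNzRingType) (d N m : nat).
Local Notation L := (laurent R d).
Local Notation coeff := ('rV[int]_d -> 'cV[pontryagin_dual K R]_N).

Definition chain_pairing (a : 'I_m -> coeff) (z : 'M[L]_(m, N)) : circle K :=
  \sum_(i < m) row_pairing (a i) (row i z).

Lemma chain_pairingD a : {morph chain_pairing a : y z / y + z}.
Proof.
move=> y z; rewrite -big_split; apply: eq_bigr => i _.
by rewrite [row i _]raddfD row_pairingD.
Qed.

Lemma chain_pairing0 a : chain_pairing a 0 = 0.
Proof. by apply: big1 => i _; rewrite [row i _]raddf0 row_pairing0. Qed.

Lemma chain_pairingB a y z :
  chain_pairing a (y - z) = chain_pairing a y - chain_pairing a z.
Proof.
apply: (addIr (chain_pairing a z)).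
by rewrite -chain_pairingD !subrK.
Qed.

Definition chain_character (a : 'I_m -> coeff) :
    pontryagin_dual K 'M[L]_(m, N) :=
  @Dual K 'M[L]_(m, N) (chain_pairing a) (asboolT (chain_pairingB a)).

Lemma chain_pairing_delta a i (u : 'rV[L]_N) :
  chain_pairing a (delta_mx i (0 : 'I_1) *m u) = row_pairing (a i) u.
Proof.
rewrite /chain_pairing (bigD1 i) //= row_delta_mul eqxx.
rewrite big1 ?addr0 // => j /negPf ji.
by rewrite row_delta_mul ji row_pairing0.
Qed.

Lemma monomial_characterB (psi : pontryagin_dual K 'M[L]_(m, N)) i n k :
  (fun s : R => psi (delta_mx i (0 : 'I_1) *m monomial_row s n k))
    \in @character_pred K R.
Proof.
by apply/asboolP => s t; rewrite monomial_rowB mulmxBr dualB.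
Qed.

(** The coordinates of a character of [R[Z^d] (x) V (x) Z^m] are its
    restrictions to the copies of [R] spanned by the elements
    [t^n (x) e_k (x) x_i]. *)
Definition character_coords (psi : pontryagin_dual K 'M[L]_(m, N)) :
    'I_m -> coeff :=
  fun i n => \col_k Dual (monomial_characterB psi i n k).

(** Characters are determined by their values on the chains
    [s t^n (x) e_k (x) x_i], which generate additively. *)
Lemma character_coordsK : cancel character_coords chain_character.
Proof.
move=> psi; apply: dual_ext => z /=.
have -> : z = \sum_i delta_mx i (0 : 'I_1) *m row i z.
  apply/matrixP => i j; rewrite summxE (bigD1 i) //= big1 ?addr0.
    by rewrite !mxE big_ord1 !mxE !eqxx mul1r.
  by move=> i' /negPf i'i; rewrite !mxE big_ord1 !mxE eq_sym i'i mul0r.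
rewrite dual_sum (big_morph _ (@chain_pairingD _) (chain_pairing0 _)).
apply: eq_bigr => i _; rewrite chain_pairing_delta.
move: (row i z); apply: monomial_row_ext.
- exact: row_pairingD.
- by move=> u v; rewrite mulmxDr dualD.
- exact: row_pairing0.
- by rewrite mulmx0 dual0.
by move=> s n k; rewrite row_pairing_monomial mxE.
Qed.

Lemma chain_characterK : cancel chain_character character_coords.
Proof.
move=> a; apply/funext => i; apply/funext => n; apply/matrixP => k j.
rewrite ord1 mxE; apply: dual_ext => s /=.
by rewrite chain_pairing_delta row_pairing_monomial.
Qed.

End ChainPairing.

Section FoxPairing.
Variables (K : realType) (R : comUnitRingType) (N q d : nat).
Variables (D : link_diagram q d) (c0 : 'I_q.+1) (G : groupType).
Variables (x : 'I_q.+1 -> G) (eps : G -> 'rV[int]_d.+1) (gamma : G -> 'M[R]_N).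
Local Notation tau := (twisted_rep eps gamma).
Local Notation act := (@dual_act K R d.+1 N G eps gamma).
Local Notation config :=
  ('I_q.+1 -> 'rV[int]_d.+1 -> 'cV[pontryagin_dual K R]_N).

(** Lifting paths and differentiating words are adjoint: both split off the
    first letter and act on the rest by it. *)
Lemma chain_pairing_path (a : config) w u :
  chain_pairing a (path_chain x tau w u) = row_pairing (fox act x a w) u.
Proof.
elim: w u => [|i w IHw] u /=.
  by rewrite chain_pairing0 row_pairing_coeff0.
rewrite chain_pairingD chain_pairing_delta row_pairing_coeffD IHw.
by rewrite row_pairing_act.
Qed.

Lemma chain_pairing_boundary (a : config) z :
  chain_pairing a (boundary2 D c0 x tau z) =
  \sum_(c < q)
    (row_pairing (fox act x a (wirtinger_relator D (lift c0 c)).1) (row c z) -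
     row_pairing (fox act x a (wirtinger_relator D (lift c0 c)).2) (row c z)).
Proof.
rewrite (big_morph _ (chain_pairingD a) (chain_pairing0 a)).
apply: eq_bigr => c _; case: (wirtinger_relator D (lift c0 c)) => w1 w2 /=.
by rewrite chain_pairingB !chain_pairing_path.
Qed.

(** The chains [u (x) r_c] with [u] arbitrary isolate the crossing [c], and
    rows separate the sequences of characters. *)
Lemma boundary_pairing_eq0 (a : config) :
  (forall z, chain_pairing a (boundary2 D c0 x tau z) = 0) <->
  (forall c : 'I_q, fox act x a (wirtinger_relator D (lift c0 c)).1 =
                    fox act x a (wirtinger_relator D (lift c0 c)).2).
Proof.
split=> [a0 c|foxE z]; last first.
  by rewrite chain_pairing_boundary; apply: big1 => c _; rewrite foxE subrr.
apply: row_pairing_inj => u; apply: subr0_eq.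
have := a0 (delta_mx c (0 : 'I_1) *m u); rewrite chain_pairing_boundary.
rewrite (bigD1 c) //= row_delta_mul eqxx big1 ?addr0 // => j /negPf jc.
by rewrite row_delta_mul jc !row_pairing0 subrr.
Qed.

Hypothesis epsM : {morph eps : g h / (g * h)%g >-> g + h}.
Hypothesis gammaP : representation gamma.

(** For the Wirtinger relator [x_i x_j = x_k x_i], the Fox derivatives of the
    two sides are [a_i + x_i a_j] and [a_k + x_k a_i]. *)
Lemma fox_crossing (a : config) c :
  crossing_equation D x eps gamma a c <->
  fox act x a (wirtinger_relator D c).1 = fox act x a (wirtinger_relator D c).2.
Proof.
have actP := dual_act_module K epsM gammaP.
rewrite /= !(module_act0 actP) !addr0.
split=> [e|e i j k n]; first by apply/funext => n; exact: e.
have := congr1 (fun b : 'rV[int]_d.+1 -> 'cV[pontryagin_dual K R]_N => b n) e.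
exact.
Qed.

End FoxPairing.

(** * The conjugacy *)

Lemma dual_actionE (K : realType) (R : comNzRingType) (d : nat)
    (M : lmodType (laurent R d)) n (chi : pontryagin_dual K M) y :
  dual_action K M n chi y = chi (tpow R n *: y).
Proof. by []. Qed.

Section Conjugacy.
Variables (K : realType) (R : comUnitRingType) (N q d : nat).
Variables (D : link_diagram q d) (c0 : 'I_q.+1) (G : groupType).
Variables (x : 'I_q.+1 -> G) (eps : G -> 'rV[int]_d.+1) (gamma : G -> 'M[R]_N).
Hypothesis presP : wirtinger_presentation D c0 x.
Hypothesis epsM : {morph eps : g h / (g * h)%g >-> g + h}.
Hypothesis gammaP : representation gamma.
Local Notation tau := (twisted_rep eps gamma).
Local Notation L := (laurent R d.+1).
Local Notation chains := 'M[L]_(q.+1, N).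
Local Notation module := (twisted_alexander D c0 x eps gamma).
Local Notation colorings := (coloring K D x eps gamma).

(** Characters of the Alexander module are studied through their pullbacks
    along this projection from the full group of 1-chains, where the arc [0]
    need not be treated apart. *)
Definition chain_class (z : chains) : module :=
  coker_pi (based_boundary D c0 x tau) (row' ord0 z).

Lemma chain_classD : {morph chain_class : y z / y + z}.
Proof. by move=> y z; rewrite /chain_class raddfD coker_piD. Qed.

Lemma chain_class_additive : nmod_morphism chain_class.
Proof.
split; last exact: chain_classD.
by apply: (addrI (chain_class 0)); rewrite -chain_classD !addr0.
Qed.

HB.instance Definition _ :=
  GRing.isNmodMorphism.Build chains module chain_class chain_class_additive.

Lemma chain_classZ a z : chain_class (a *: z) = a *: chain_class z.
Proof. by rewrite /chain_class linearZ /= -coker_piZ. Qed.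

Lemma chain_class_surj y : exists z, chain_class z = y.
Proof.
(* An arbitrary representative in [Y], extended by [0] along [W]. *)
exists (\matrix_(i, j)
  if unlift ord0 i is Some k then coker_repr y k j else 0).
rewrite -[RHS]coker_reprK; congr coker_pi.
by apply/matrixP => i j; rewrite !mxE liftK.
Qed.

Lemma chain_class_eq0 z :
  chain_class z = 0 <->
  exists w, row' ord0 (boundary2 D c0 x tau w) = row' ord0 z.
Proof.
have -> : 0 = chain_class 0 by rewrite raddf0.
by rewrite /chain_class coker_pi_eq [row' ord0 0]raddf0 subr0.
Qed.

(** The class of a 1-chain in the module forgets the component along [W]; so
    does the pairing with a configuration which vanishes on the arc [0]. *)
Lemma chain_pairing_row' (a : 'I_q.+1 -> 'rV[int]_d.+1 ->
    'cV[pontryagin_dual K R]_N) (y z : chains) :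
  a ord0 = 0 -> row' ord0 y = row' ord0 z ->
  chain_pairing a y = chain_pairing a z.
Proof.
move=> a0 yz; rewrite /chain_pairing !big_ord_recl a0.
rewrite !row_pairing_coeff0 !add0r.
apply: eq_bigr => i _; congr row_pairing.
by apply/rowP => j; have /matrixP/(_ i j) := yz; rewrite !mxE.
Qed.

(** The pullback of [chi] kills [W], whence the value [0] on the arc [0], and
    the boundaries, whence the crossing equations other than that of [c0]; the
    latter follows from [fox_presented]. *)
Lemma coords_coloring (chi : pontryagin_dual K module) :
  character_coords (dual_map chain_class chi)
    \in coloring_pred (K := K) D x eps gamma.
Proof.
set psi := dual_map chain_class chi; set a := character_coords psi.
have psiE z : chain_pairing a z = psi z.
  by rewrite -[in RHS](character_coordsK psi).
apply/asboolP; split=> [n|c].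
  apply/matrixP => k j; rewrite !mxE; apply: dual_ext => s /=.
  rewrite -[RHS](dual0 chi) -(raddf0 chain_class); congr (chi _).
  congr coker_pi; rewrite [RHS]raddf0.
  by apply/matrixP => i l; rewrite !mxE big_ord1 !mxE mul0r.
apply/(fox_crossing D x epsM gammaP).
apply: (fox_presented (dual_act_module K epsM gammaP) presP.1.1 presP.2).
apply/boundary_pairing_eq0 => z; rewrite psiE /=.
rewrite (_ : chain_class _ = 0) ?dual0 //.
by apply/chain_class_eq0; exists z.
Qed.

Definition dual_coloring (chi : pontryagin_dual K module) : colorings :=
  Coloring (coords_coloring chi).

Lemma dual_coloringB : zmod_morphism dual_coloring.
Proof.
move=> chi psi; apply/val_inj/funext => i; apply/funext => n.
by apply/matrixP => k j; rewrite !mxE; apply: dual_ext.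
Qed.

HB.instance Definition _ :=
  GRing.isZmodMorphism.Build (pontryagin_dual K module) colorings dual_coloring
    dual_coloringB.

Lemma dual_coloring_inj : injective dual_coloring.
Proof.
move=> chi psi /(congr1 (@coloring_fun _ _ _ _ _ _ _ _ _ _)) /=.
move=> /(can_inj (@character_coordsK _ _ _ _ _)) e.
apply: dual_ext => y; have [z <-] := chain_class_surj y.
have := congr1 (fun f : pontryagin_dual K chains => f z) e.
exact.
Qed.

Lemma dual_coloring_surj a : exists chi, dual_coloring chi = a.
Proof.
have /asboolP[a0 aP] := coloring_funP a.
have a0' : a ord0 = 0 by apply/funext.
have cycles w : chain_pairing a (boundary2 D c0 x tau w) = 0.
  move: w; apply/boundary_pairing_eq0 => c.
  exact/(fox_crossing D x epsM gammaP).
have [|z z0|chi chiE] := @dual_factor K _ _ chain_class (chain_character a).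
- exact: chain_class_surj.
- have /chain_class_eq0[w wz] := z0.
  by rewrite /= -(chain_pairing_row' a0' wz).
by exists chi; apply: val_inj; rewrite /= chiE chain_characterK.
Qed.

Lemma dual_coloring_bij : bijective dual_coloring.
Proof.
have [g gK] := choice dual_coloring_surj.
by exists g => // chi; apply: dual_coloring_inj; rewrite gK.
Qed.

Lemma dual_coloringE chi i n k j s :
  dual_coloring chi i n k j s =
  chi (chain_class (delta_mx i (0 : 'I_1) *m monomial_row s n k)).
Proof. by rewrite mxE. Qed.

(** Both topologies are topologies of pointwise convergence, and every
    coordinate of the coloring of [chi] is a value of [chi]. *)
Lemma dual_coloring_continuous : continuous dual_coloring.
Proof.
apply: (@continuous_comp_initial _ _ _
  (@coloring_fun K R N q d D G x eps gamma : colorings ->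
     {ptws 'I_q.+1 -> {ptws 'rV[int]_d.+1 -> 'cV[pontryagin_dual K R]_N}})).
apply: continuous_ptws => i; apply: continuous_ptws => n.
apply: continuous_mx => k j; apply: continuous_dual => s.
have -> : (fun chi => dual_coloring chi i n k j s) =
    (fun chi =>
       chi (chain_class (delta_mx i (0 : 'I_1) *m monomial_row s n k))).
  by apply/funext => chi; apply: dual_coloringE.
exact: dual_eval_continuous.
Qed.

(** Multiplication by [t^n] moves the copy of [R] at [t^m] to the one at
    [t^(m + n)]. *)
Lemma dual_coloring_shift n chi :
  dual_coloring (dual_action K module n chi) =
  coloring_shift K D x eps gamma n (dual_coloring chi).
Proof.
apply/val_inj/funext => i; apply/funext => m.
apply/matrixP => k j; apply: dual_ext => s.
rewrite dual_coloringE dual_actionE -chain_classZ scalemxAr tpow_monomial_row.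
by rewrite -(dual_coloringE _ _ _ _ j).
Qed.

End Conjugacy.

Theorem theorem3p5 (K : realType) (q d N : nat)
    (S : {pred rat}) (R : subComUnitRingType S)
    (D : link_diagram q d) (c0 : 'I_q.+1)
    (pi : groupType) (x : 'I_q.+1 -> pi)
    (hx : wirtinger_presentation D c0 x)
    (eps : pi -> 'rV[int]_d.+1) (heps : abelianization D x eps)
    (gamma : pi -> 'M[R]_N) (hgamma : representation gamma) :
  topologically_conjugate
    (dual_action K (twisted_alexander D c0 x eps gamma))
    (coloring_shift K D x eps gamma).
Proof.
exists (dual_coloring hx heps.1 hgamma); split.
- exact: dual_coloring_bij.
- exact: dual_coloring_continuous.
- exact: dual_coloring_shift.
Qed.
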